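(* Let $I$ be a fractional ideal of a Dedekind domain $R$. Then $v_{\mathfrak{p}}(I)$ is $0$ for all but a finite number of nonzero prime ideals $\mathfrak{p}$ of $R$. Suppose $\mathfrak{p}_1, \ldots, \mathfrak{p}_k$ are distinct nonzero prime ideals of $R$ that include at least all nonzero prime ideals $\mathfrak{p}$ with $v_{\mathfrak{p}}(I) \ne 0$. Then $$I = \mathfrak{p}_1^{v_{\mathfrak{p}_1}(I)} \cdots \mathfrak{p}_k^{v_{\mathfrak{p}_k}(I)}.$$
   Context: A Dedekind domain is an integral domain that is Noetherian, integrally closed in its fraction field, and in which every nonzero prime ideal is maximal (fields are regarded as Dedekind domains). Let $K$ be the fraction field of $R$. A fractional ideal of $R$ is a nonzero $R$-submodule $I$ of $K$ such that $xI\subseteq R$ for some $x\in K^\times$. For a Dedekind domain the fractional ideals form an abelian group under the product of submodules (finite sums of products), with identity $R$; integer powers of fractional ideals are taken in this group, and the empty product is $R$. For a nonzero prime ideal $\mathfrak{p}$ of $R$, the localization $R_{\mathfrak{p}}$ is a discrete valuation ring, whose fractional ideals are exactly the distinct powers $(\mathfrak{p}R_{\mathfrak{p}})^k$, $k\in\mathbb{Z}$. For a fractional ideal $I$ of $R$, $v_{\mathfrak{p}}(I)$ is the unique $k\in\mathbb{Z}$ such that $IR_{\mathfrak{p}}=(\mathfrak{p}R_{\mathfrak{p}})^k$, where $IR_{\mathfrak{p}}$ is the localization of $I$ at $\mathfrak{p}$ inside $K$. *)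

(* Defs.v *)
From HB Require Import structures.
From mathcomp Require Import all_boot all_order all_algebra.
From mathcomp Require Import ring_quotient.
From mathcomp Require Import boolp classical_sets functions cardinality.

Set Implicit Arguments.
Unset Strict Implicit.
Unset Printing Implicit Defensive.

Import GRing.Theory.
Local Open Scope classical_set_scope.
Local Open Scope ring_scope.

Notation "x %:F" := (@tofrac _ x) : ring_scope.

(* Ideals are classical sets, seen as predicates through their (classical)
   boolean membership.  In ring_quotient, [idealr_closed] means *proper* ideal
   (it includes 1 \notin S); a possibly improper ideal is a submodule of R^o. *)
Definition ideal (R : idomainType) (I : set R) : Prop :=
  submod_closed ([in I] : {pred R^o}).

Definition proper_ideal_set (R : idomainType) (P : set R) : Prop :=
  idealr_closed [in P].

Definition nonzero_prime (R : idomainType) (P : set R) : Prop :=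
  [/\ proper_ideal_set P, prime_idealr_closed [in P] & P <> [set 0]].

Definition finitely_generated (R : idomainType) (I : set R) : Prop :=
  exists (n : nat) (g : 'I_n -> R),
    I = [set x | exists c : 'I_n -> R, x = \sum_(i < n) c i * g i].

Definition noetherian (R : idomainType) : Prop :=
  forall I : set R, ideal I -> finitely_generated I.

Definition integrally_closed (R : idomainType) : Prop :=
  forall z : {fraction R},
    integralOver (@tofrac R) z -> exists a : R, z = a%:F.

(* Fields are not excluded. *)
Definition dedekind (R : idomainType) : Prop :=
  [/\ noetherian R, integrally_closed R &
      forall P Q : set R,
        nonzero_prime P -> proper_ideal_set Q -> P `<=` Q -> Q = P].

(* In what follows A is a subring of K with fraction field K; it is used with
   A = R and A = R_P, both regarded as subsets of K = {fraction R}. *)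
Section FractionalIdeals.
Variable K : fieldType.
Implicit Types A I J : set K.

Definition submodule A I : Prop :=
  [/\ I 0,
      forall x y, I x -> I y -> I (x + y) &
      forall a x, A a -> I x -> I (a * x)].

Definition fractional_ideal A I : Prop :=
  [/\ submodule A I,
      exists2 y, I y & y != 0 &
      exists2 x, x != 0 & forall y, I y -> A (x * y)].

Definition mul_submod I J : set K :=
  [set x | exists (n : nat) (a b : 'I_n -> K),
     [/\ forall i, I (a i), forall i, J (b i) & x = \sum_(i < n) a i * b i]].

(* The inverse in the group of fractional ideals of A.  The default value set0
   is only returned when I is not invertible. *)
Definition inv_frac A I : set K :=
  xget set0 [set J | fractional_ideal A J /\ mul_submod I J = A].

Definition exp_frac A I (k : int) : set K :=
  match k with
  | Posz n => iter n (mul_submod I) A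
  | Negz n => iter n.+1 (mul_submod (inv_frac A I)) A
  end.

End FractionalIdeals.

Section Valuation.
Variable R : idomainType.
Implicit Types (P : set R) (I : set {fraction R}).

Definition frac_image P : set {fraction R} := [set a%:F | a in P].

Definition base_ring : set {fraction R} := frac_image [set: R].

Definition localize P I : set {fraction R} :=
  [set x | exists (a : {fraction R}) (s : R), [/\ I a, ~ P s & x = a / s%:F]].

(* The k such that I R_P = (P R_P)^k, powers being taken in the group of
   fractional ideals of R_P.  It exists and is unique when R is Dedekind, P is a
   nonzero prime and I is a fractional ideal of R; the default value 0 is then
   never used. *)
Definition valuation P I : int :=
  xget (0 : int) [set k | localize P I =
    exp_frac (localize P base_ring) (localize P (frac_image P)) k].

End Valuation.

Arguments base_ring R : clear implicits.

(* Main.v *)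
Require Import Defs.
From HB Require Import structures.
From mathcomp Require Import all_boot all_order all_algebra.
From mathcomp Require Import boolp classical_sets functions cardinality.

Local Open Scope classical_set_scope.
Local Open Scope ring_scope.

Set Implicit Arguments.
Unset Strict Implicit.
Unset Printing Implicit Defensive.

Import GRing.Theory.

(** Submodules are compared prime by prime: two nonzero submodules of the fraction
    field with the same localization at every nonzero prime are equal
    ([sub_local_global]).  Localization commutes with products and powers
    ([localize_mul], [localize_exp]), so at a prime [P] a product of powers of
    distinct primes becomes the power of [P] alone ([localize_prime_product]),
    and by definition of the valuation the localization of [I] is this same power.

    For this to make sense, two facts about a Dedekind domain are needed.

    - Every nonzero prime [P] is invertible ([nonzero_prime_inverse]).  The
      candidate is the set of the [z] that multiply [P] into [R]; integral
      closedness shows that no [z] outside [R] stabilizes a nonzero ideal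
      ([stable_base_ring]), and Noetherian induction together with the
      maximality of nonzero primes produces some [z] outside [R] in the
      candidate ([saturated_quotient_prime], [exists_conductor]).
    - The valuation exists ([valuationP]): an ideal contained in [P] grows
      strictly when multiplied by the inverse of [P], so after finitely many
      steps it escapes from [P] and becomes trivial at [P]
      ([localize_ideal_power]); a fractional ideal is a quotient of two ideals.
      Uniqueness matters only for the exponent 0, and holds because [P] remains
      proper in the localization at [P] ([exp_frac_eq1]).

    Finally, a fractional ideal is trivial at every prime that does not contain a
    certain nonzero element of [R], and a nonzero ideal lies in finitely many
    primes, again by Noetherian induction ([finite_primes_above]). *)

(** * Products and powers of submodules *)

Section Products.
Variable K : fieldType.
Implicit Types A I J L M : set K.

Definition additive_set L := L 0 /\ forall x y, L x -> L y -> L (x + y).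

Lemma additive_sum L n (f : 'I_n -> K) :
  additive_set L -> (forall i, L (f i)) -> L (\sum_(i < n) f i).
Proof. by move=> [L0 LD] Lf; apply: big_ind. Qed.

Lemma additive_mul_submod I J : additive_set (mul_submod I J).
Proof.
split=> [|_ _ [n [a [b [aI bJ ->]]]] [m [c [d [cI dJ ->]]]]].
  by exists 0%N, (fun=> 0), (fun=> 0); split=> [[]|[]|] //; rewrite big_ord0.
pose cat (f : 'I_n -> K) (g : 'I_m -> K) (i : 'I_(n + m)) :=
  match fintype.split i with inl j => f j | inr j => g j end.
exists (n + m)%N, (cat a c), (cat b d); split.
- by move=> i; rewrite /cat; case: (fintype.split i).
- by move=> i; rewrite /cat; case: (fintype.split i).
rewrite big_split_ord /=; congr (_ + _); apply: eq_bigr => i _; rewrite /cat.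
- by case: split_ordP => j => [/lshift_inj->|/eqP] //; rewrite eq_lrshift.
- by case: split_ordP => j => [/eqP|/rshift_inj->] //; rewrite eq_rlshift.
Qed.

Lemma mem_mul_submod I J x y : I x -> J y -> mul_submod I J (x * y).
Proof.
move=> Ix Jy; exists 1%N, (fun=> x), (fun=> y); split=> //.
by rewrite big_ord1.
Qed.

(** The universal property of the product: every inclusion of a product into
    another set is checked on products of two elements, so that sums need not
    be manipulated again. *)
Lemma mul_submod_sub I J L : additive_set L ->
  (forall x y, I x -> J y -> L (x * y)) -> mul_submod I J `<=` L.
Proof.
move=> Ladd IJL _ [n [a [b [aI bJ ->]]]].
by apply: additive_sum => // i; apply: IJL.
Qed.

Lemma mul_submodS I I' J J' :
  I `<=` I' -> J `<=` J' -> mul_submod I J `<=` mul_submod I' J'.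
Proof.
move=> sI sJ; apply: mul_submod_sub (additive_mul_submod _ _) _ => x y Ix Jy.
by apply: mem_mul_submod; [apply: sI|apply: sJ].
Qed.

Lemma mul_submodC I J : mul_submod I J = mul_submod J I.
Proof.
by apply/seteqP; split; apply: mul_submod_sub (additive_mul_submod _ _) _
  => x y Ix Jy; rewrite mulrC; apply: mem_mul_submod.
Qed.

Lemma mul_submodA I J L :
  mul_submod I (mul_submod J L) = mul_submod (mul_submod I J) L.
Proof.
have sub I' J' L' :
    mul_submod I' (mul_submod J' L') `<=` mul_submod (mul_submod I' J') L'.
  have [m0 mD] := additive_mul_submod (mul_submod I' J') L'.
  apply: mul_submod_sub => // x z Ix.
  move: z; apply: mul_submod_sub => [|y z Jy Lz].
    by split=> [|y z]; rewrite ?mulr0 ?mulrDr //; apply: mD.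
  by rewrite mulrA; do 2?apply: mem_mul_submod.
apply/seteqP; split=> //.
rewrite (mul_submodC (mul_submod I J)) (mul_submodC I J).
by rewrite (mul_submodC I) (mul_submodC J L).
Qed.

Lemma mul_submodCA I J L :
  mul_submod I (mul_submod J L) = mul_submod J (mul_submod I L).
Proof. by rewrite mul_submodA (mul_submodC I) -mul_submodA. Qed.

Lemma submodule_additive A I : submodule A I -> additive_set I.
Proof. by case. Qed.

Lemma submodule_mul A I J : submodule A I -> submodule A (mul_submod I J).
Proof.
case=> _ _ IZ; have [m0 mD] := additive_mul_submod I J.
split=> // a x Aa; move: x; apply: mul_submod_sub => [|x y Ix Jy].
  by split=> [|x y]; rewrite ?mulr0 ?mulrDr //; apply: mD.
by rewrite mulrA; apply: mem_mul_submod => //; apply: IZ.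
Qed.

(** Sums, products and [1] are all that makes [A] neutral among its submodules. *)
Definition unital A := submodule A A /\ A 1.

Section Powers.
Variable A : set K.
Hypothesis unitA : unital A.

Lemma mul1_submod I : submodule A I -> mul_submod A I = I.
Proof.
move=> Isub; case: (Isub) => _ _ IZ; apply/seteqP; split=> [|x Ix].
  exact: mul_submod_sub (submodule_additive Isub) _.
by rewrite -[x]mul1r; apply: mem_mul_submod => //; apply: unitA.2.
Qed.

Lemma mul_submod1 I : submodule A I -> mul_submod I A = I.
Proof. by rewrite mul_submodC; apply: mul1_submod. Qed.

Lemma inv_frac_unique I J :
  fractional_ideal A J -> mul_submod I J = A -> inv_frac A I = J.
Proof.
move=> Jfr IJ; apply: xget_unique => // J' [J'fr IJ'].
have [[Jsub _ _] [J'sub _ _]] := (Jfr, J'fr).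
by rewrite -(mul1_submod J'sub) -IJ -mul_submodA mul_submodCA IJ' mul_submod1.
Qed.

Lemma submodule_iter I n :
  submodule A (iter n (mul_submod I) A).
Proof.
case: n => [|n]; first exact: unitA.1.
elim: n => [|n IHn]; rewrite iterS mul_submodC.
  exact: submodule_mul unitA.1.
exact: submodule_mul IHn.
Qed.

Lemma submodule_exp I k : submodule A (exp_frac A I k).
Proof. by case: k => n; apply: submodule_iter. Qed.

Lemma mul_submodKl I J M :
  submodule A M -> mul_submod I J = A -> mul_submod J (mul_submod I M) = M.
Proof. by move=> Msub IJ; rewrite mul_submodA (mul_submodC J) IJ mul1_submod. Qed.

Section Invertible.
Variables I J : set K.
Hypotheses (Jfr : fractional_ideal A J) (IJ : mul_submod I J = A).

Lemma exp_fracS k : mul_submod I (exp_frac A I k) = exp_frac A I (k + 1).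
Proof.
case: k => [n|n]; first by rewrite -PoszD addn1.
rewrite {1}/exp_frac (inv_frac_unique Jfr IJ) iterS mul_submodA IJ.
rewrite mul1_submod; last exact: submodule_iter.
case: n => [//|n]; have -> : (Negz n.+1 + 1 = Negz n)%R.
  by rewrite !NegzE -[n.+2]addn1 PoszD opprD addrNK.
by rewrite /exp_frac (inv_frac_unique Jfr IJ).
Qed.

Lemma exp_fracD n k :
  mul_submod (exp_frac A I (Posz n)) (exp_frac A I k) = exp_frac A I (n%:Z + k).
Proof.
elim: n => [|n IHn]; first by rewrite add0r mul1_submod //; apply: submodule_exp.
rewrite -[X in Posz X]addn1 PoszD -exp_fracS -mul_submodA IHn exp_fracS.
by rewrite addrAC.
Qed.

Lemma exp_frac_cancel n L M : submodule A L -> submodule A M ->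
  mul_submod (exp_frac A I (Posz n)) L = mul_submod (exp_frac A I (Posz n)) M ->
  L = M.
Proof.
move=> Lsub Msub; elim: n => [|n IHn]; first by rewrite /= !mul1_submod.
rewrite -[X in Posz X]addn1 PoszD -exp_fracS -!mul_submodA => eqLM; apply: IHn.
have expM N : submodule A (mul_submod (exp_frac A I n) N).
  exact/submodule_mul/submodule_exp.
by rewrite -[LHS](mul_submodKl (expM _) IJ) eqLM mul_submodKl.
Qed.

(** If a power of [I] other than the zeroth were trivial, then so would be one
    with positive exponent, which lies inside [I]. *)
Lemma exp_frac_eq1 k : submodule A I -> I `<=` A -> I <> A ->
  exp_frac A I k = A -> k = 0.
Proof.
move=> Isub sIA IneA; suff pos n : exp_frac A I (Posz n) = A -> n = 0%N.
  case: k => [n /pos -> //|n negA].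
  have : exp_frac A I (Posz n.+1) = A.
    rewrite -[LHS]mul_submod1; last exact: submodule_exp.
    by rewrite -[X in mul_submod _ X]negA exp_fracD NegzE subrr.
  by move/pos.
case: n => // n eqA; case: IneA; apply/seteqP; split=> // x.
rewrite -eqA => Ax; rewrite -(mul_submod1 Isub); move: x Ax.
apply: mul_submodS => //.
elim: n {eqA} => // n IHn /=; rewrite -[X in _ `<=` X](mul1_submod unitA.1).
exact: mul_submodS.
Qed.

End Invertible.

Lemma exp_frac1 k : exp_frac A A k = A.
Proof.
have AA : mul_submod A A = A by apply: mul1_submod unitA.1.
have Afr : fractional_ideal A A.
  split; first exact: unitA.1.
    by exists 1; [apply: unitA.2|apply: oner_neq0].
  by exists 1 => [|y]; rewrite ?oner_neq0 ?mul1r.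
by case: k => n; rewrite /exp_frac ?(inv_frac_unique Afr AA); elim: n => //= n ->.
Qed.

(** [A] is neutral for submodules only, not for all sets, so that the product is
    not a monoid law and the general lemmas on iterated operators do not apply. *)
Lemma big_mul_submod_single (T : eqType) (s : seq T) (t : T) (F : T -> set K) :
    uniq s -> submodule A (F t) -> (forall u, u != t -> F u = A) ->
  \big[@mul_submod K/A]_(u <- s) F u = if t \in s then F t else A.
Proof.
move=> s_uniq Ft FA; elim: s s_uniq => [|u s IHs] /= => [_|/andP[us s_uniq]].
  by rewrite big_nil.
rewrite big_cons IHs // inE; have [etu|tu] /= := eqVneq t u.
  by subst u; rewrite (negbTE us) mul_submod1.
rewrite FA 1?eq_sym // mul1_submod //; case: ifP => // _; exact: unitA.1.
Qed.

End Powers.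
End Products.

(** * Ideals of a Noetherian domain *)

Section Ideals.
Variable R : idomainType.
Implicit Types I J P Q : set R.

Lemma idealP I : ideal I <->
  [/\ I 0, forall x y, I x -> I y -> I (x + y) & forall a x, I x -> I (a * x)].
Proof.
split=> [[/set_mem I0 Ilin]|[I0 ID IZ]].
  have Imul a x : I x -> I (a * x).
    by move=> Ix; rewrite -[a * x]addr0; apply/set_mem/Ilin; apply/mem_set.
  split=> // x y Ix Iy.
  by rewrite -[x]mul1r; apply/set_mem/Ilin; apply/mem_set.
split; first exact/mem_set.
by move=> a x y /set_mem Ix /set_mem Iy; apply/mem_set/ID => //; apply: IZ.
Qed.

Lemma proper_ideal_setP I : proper_ideal_set I <-> ideal I /\ ~ I 1.
Proof.
split=> [[I0 /negP I1 Ilin]|[[I0 Ilin] I1]].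
  by split=> [|I1']; [split|apply/I1/mem_set].
split=> //; first by apply/negP => /set_mem.
Qed.

Lemma nonzero_primeP P : nonzero_prime P <->
  [/\ ideal P, ~ P 1, forall x y, P (x * y) -> P x \/ P y
    & exists2 x, P x & x != 0].
Proof.
split=> [[/proper_ideal_setP[Pid P1] Ppr Pn0]|[Pid P1 Ppr [x Px xn0]]].
  split=> // [x y Pxy|].
    by have /orP[] := Ppr x y (mem_set Pxy) => /set_mem; [left|right].
  apply: contrapT => Pz; apply: Pn0; apply/seteqP; split=> x /=; last first.
    by move=> ->; case/idealP: Pid.
  by move=> Px; apply: contrapT => /eqP xn0; apply: Pz; exists x.
split; first exact/proper_ideal_setP.
  by move=> x' y /set_mem /Ppr [] /mem_set H; apply/orP; [left|right].
by move=> P0; move: Px xn0; rewrite P0 => ->; rewrite eqxx.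
Qed.

Lemma ideal_sum I n (f : 'I_n -> R) :
  ideal I -> (forall i, I (f i)) -> I (\sum_(i < n) f i).
Proof. by move=> /idealP[I0 ID _] If; apply: big_ind. Qed.

Lemma prime_prod P n (f : 'I_n -> R) : nonzero_prime P ->
  (forall i, ~ P (f i)) -> ~ P (\prod_(i < n) f i).
Proof.
move=> /nonzero_primeP[_ P1 Ppr _] Pf; apply: (big_ind (fun x => ~ P x)) => //.
by move=> x y Px Py /Ppr[].
Qed.

Lemma generator_mem n (g : 'I_n -> R) i :
  exists c : 'I_n -> R, g i = \sum_(j < n) c j * g j.
Proof.
exists (fun j => (j == i)%:R).
rewrite (bigD1 i) //= eqxx mul1r big1 ?addr0 // => j /negPf ->.
by rewrite mul0r.
Qed.

(** A failure of the conclusion would produce, by choice, an infinite strictly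
    increasing chain of ideals; the finitely many generators of its union
    already lie in one member of the chain. *)
Lemma noetherian_ind (C : set R -> Prop) : noetherian R ->
    (forall J, ideal J ->
       (forall J', ideal J' -> J `<` J' -> C J') -> C J) ->
  forall J, ideal J -> C J.
Proof.
move=> noethR step J Jid; apply: contrapT => CJ.
pose bad := {J : set R | ideal J /\ ~ C J}.
have /choice[next nextP] : forall u : bad, exists v : bad, sval u `<` sval v.
  case=> I [Iid CI]; apply: contrapT => maxI; apply/CI/step => // I' I'id ltII'.
  apply: contrapT => CI'; apply: maxI.
  by exists (exist _ I' (conj I'id CI')).
pose c n := sval (iter n next (exist _ J (conj Jid CJ))).
have cid n : ideal (c n) by rewrite /c; case: (iter _ _ _) => I [].
have cS n : c n `<` c n.+1 by apply: nextP.
have cmono m n : (m <= n)%N -> c m `<=` c n.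
  move=> /subnK <-; elim: (n - m)%N => // k IHk.
  exact: subset_trans IHk (properW (cS _)).
have Uid : ideal (\bigcup_n c n).
  apply/idealP; split=> [|x y [m _ cx] [n _ cy]|a x [n _ cx]].
  - by exists 0%N => //; case/idealP: (cid 0%N).
  - exists (maxn m n) => //; have [_ cD _] := (idealP _).1 (cid (maxn m n)); apply: cD.
      exact: cmono (leq_maxl _ _) _ cx.
    exact: cmono (leq_maxr _ _) _ cy.
  - by exists n => //; case/idealP: (cid n) => _ _; apply.
have [n [g Ug]] := noethR _ Uid.
have /choice[N cN] : forall i, exists N, c N (g i).
  move=> i; have [N _ cg] : (\bigcup_n c n) (g i)
    by rewrite Ug; apply: generator_mem.
  by exists N.
pose M := (\max_(i < n) N i)%N; have [_] := cS M; apply => x cx.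
have : (\bigcup_n c n) x by exists M.+1.
rewrite Ug => -[a ->]; apply: ideal_sum => // i.
case/idealP: (cid M) => _ _; apply.
exact: cmono (leq_bigmax i) _ (cN i).
Qed.

Definition ideal_adjoin J x : set R :=
  [set r | exists u a, J u /\ r = u + a * x].

Lemma ideal_adjoinP J x : ideal J -> ideal (ideal_adjoin J x).
Proof.
move=> /idealP[J0 JD JZ]; apply/idealP; split.
- by exists 0, 0; rewrite mul0r addr0.
- move=> _ _ [u [a [Ju ->]]] [v [b [Jv ->]]]; exists (u + v), (a + b).
  by split; [apply: JD|rewrite mulrDl addrACA].
- move=> b _ [u [a [Ju ->]]]; exists (b * u), (b * a).
  by split; [apply: JZ|rewrite mulrDr mulrA].
Qed.

Lemma ideal_adjoin_proper J x : ideal J -> ~ J x -> J `<` ideal_adjoin J x.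
Proof.
move=> /idealP[J0 _ _] Jx; split=> [y Jy|sub].
  by exists y, 0; rewrite mul0r addr0.
by apply/Jx/sub; exists 0, 1; rewrite mul1r add0r.
Qed.

Lemma ideal_adjoin_sub J P x :
  ideal P -> J `<=` P -> P x -> ideal_adjoin J x `<=` P.
Proof.
move=> /idealP[_ PD PZ] JP Px _ [u [a [Ju ->]]].
by apply: PD; [apply: JP|apply: PZ].
Qed.

Lemma not_primeP J : ideal J -> ~ J 1 -> (exists2 x, J x & x != 0) ->
  nonzero_prime J \/ exists x y, [/\ ~ J x, ~ J y & J (x * y)].
Proof.
move=> Jid J1 Jn0; have [|npr] := pselect (nonzero_prime J); first by left.
right; apply: contrapT => noxy; apply: npr; apply/nonzero_primeP; split=> //.
move=> x y Jxy; apply: contrapT => /not_orP[Jx Jy].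
by apply: noxy; exists x, y.
Qed.

(** A maximal proper ideal is prime, in the form of an induction: if [x * y] is
    in [J] but [y] is not, then adjoining [x] to [J] cannot produce [1]. *)
Lemma sub_nonzero_prime J : noetherian R -> ideal J -> ~ J 1 ->
  (exists2 x, J x & x != 0) -> exists2 P, nonzero_prime P & J `<=` P.
Proof.
move=> noethR; move: J; apply: noetherian_ind => // J Jid IHJ J1 Jn0.
have [Jpr|[x [y [Jx Jy Jxy]]]] := not_primeP Jid J1 Jn0; first by exists J.
have ltJ := ideal_adjoin_proper Jid Jx.
have [||P Ppr sP] := IHJ _ (ideal_adjoinP x Jid) ltJ.
- move=> [u [a [Ju eq1]]]; apply: Jy; rewrite -[y]mul1r eq1 mulrDl -mulrA.
  by case/idealP: Jid => _ JD JZ; rewrite mulrC; apply: JD; apply: JZ.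
- by case: Jn0 => z Jz zn0; exists z => //; apply: ltJ.1.
by exists P => //; apply: subset_trans sP; apply: properW.
Qed.

Section Dedekind.
Hypothesis dedR : dedekind R.

Lemma nonzero_prime_maximal P Q :
  nonzero_prime P -> nonzero_prime Q -> P `<=` Q -> P = Q.
Proof.
case: dedR => _ _ maxP Ppr [Qid _ _] PQ.
by rewrite (maxP P Q).
Qed.

(** If [x * y] is in [J], a prime above [J] contains [x] or [y], so it is above
    one of two larger ideals; a nonzero prime [J] is below itself only. *)
Lemma finite_primes_above J : ideal J -> (exists2 x, J x & x != 0) ->
  finite_set [set P | nonzero_prime P /\ J `<=` P].
Proof.
have noethR : noetherian R by case: dedR.
move: J; apply: noetherian_ind => // J Jid IHJ Jn0.
have [J1|J1] := pselect (J 1).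
  apply: (sub_finite_set _ (finite_set0 _)) => P [/nonzero_primeP[_ P1 _ _] JP].
  exact/P1/JP.
have [Jpr|[x [y [Jx Jy Jxy]]]] := not_primeP Jid J1 Jn0.
  apply: (sub_finite_set _ (finite_set1 J)) => P [Ppr JP] /=.
  by rewrite (nonzero_prime_maximal Jpr Ppr).
have fin z : ~ J z ->
    finite_set [set P | nonzero_prime P /\ ideal_adjoin J z `<=` P].
  move=> Jz; have ltJ := ideal_adjoin_proper Jid Jz.
  apply: IHJ => //; first exact: ideal_adjoinP.
  by case: Jn0 => t Jt tn0; exists t => //; apply: ltJ.1.
have := conj (fin x Jx) (fin y Jy); rewrite -finite_setU.
apply: sub_finite_set => P [Ppr JP]; have /nonzero_primeP[Pid _ Pmul _] := Ppr.
by have [Px|Py] := Pmul _ _ (JP _ Jxy); [left|right];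
  split=> //; apply: ideal_adjoin_sub.
Qed.

(** The hypothesis on [J] says that [J] is the contraction of its extension to
    the localization at [Q]; it passes to the quotients of [J] by elements
    outside [J] and forces proper ideals to lie in [Q].  If [J] is not [Q], it is
    not prime, say [x * y] is in [J]; then the quotient of [J] by [x] is larger,
    since it contains [y], and a solution [b] for it gives [b * x] for [J]. *)
Lemma saturated_quotient_prime Q J : nonzero_prime Q ->
    ideal J -> (exists2 x, J x & x != 0) -> ~ J 1 ->
    (forall s x, ~ Q s -> J (s * x) -> J x) ->
  exists2 b, ~ J b & forall q, Q q -> J (q * b).
Proof.
have noethR : noetherian R by case: dedR.
move=> Qpr; move: J; apply: noetherian_ind => // J Jid IHJ Jn0 J1 satJ.
have JQ : J `<=` Q.
  move=> s Js; apply: contrapT => Qs; apply: J1.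
  by apply: (satJ s) => //; rewrite mulr1.
have [Jpr|[x [y [Jx Jy Jxy]]]] := not_primeP Jid J1 Jn0.
  by exists 1 => // q; rewrite mulr1 (nonzero_prime_maximal Jpr Qpr).
have [_ _ JZ] := (idealP J).1 Jid.
pose J' := [set r | J (r * x)].
have subJ : J `<=` J' by move=> r Jr; rewrite /J' /= mulrC; apply: JZ.
have [||||s q|b Jbx QJ] := IHJ J'.
- case/idealP: Jid => J0 JD _; apply/idealP; rewrite /J'; split=> [|r t|a r] /=.
  + by rewrite mul0r.
  + by rewrite mulrDl; apply: JD.
  + by rewrite -mulrA; apply: JZ.
- by split=> // /(_ y) sub; apply/Jy/sub; rewrite /J' /= mulrC.
- by case: Jn0 => t Jt tn0; exists t => //; apply: subJ.
- by rewrite /J' /= mul1r.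
- by rewrite /J' /= -mulrA; apply: satJ.
by exists (b * x) => // q Qq; rewrite mulrA; apply: QJ.
Qed.

(** In terms of fractions, [b / a] is not in [R] but multiplies [Q] into [R].
    The pair comes from the previous lemma applied to the contraction of the
    ideal that [a] generates in the localization at [Q]; the denominators it
    leaves are made uniform over a finite set of generators of [Q]. *)
Lemma exists_conductor Q : nonzero_prime Q -> exists a b : R,
  [/\ a != 0, ~ (exists c, b = c * a)
    & forall q, Q q -> exists c, q * b = c * a].
Proof.
move=> Qpr; have [Qid Q1 Qmul [a Qa an0]] := (nonzero_primeP Q).1 Qpr.
have [_ _ QZ] := (idealP Q).1 Qid.
pose J := [set r | exists2 s, ~ Q s & exists c, s * r = c * a].
have [|||s x Qs|b Jb QJ] := saturated_quotient_prime (J := J) Qpr.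
- apply/idealP; split.
  + by exists 1 => //; exists 0; rewrite mul0r mulr0.
  + move=> x y [s Qs [c sx]] [t Qt [d ty]]; exists (s * t).
      by move/Qmul=> [].
    exists (t * c + s * d).
    by rewrite mulrDr mulrDl -!mulrA -sx -ty mulrCA !mulrA [t * s]mulrC.
  + move=> d x [s Qs [c sx]]; exists s => //; exists (d * c).
    by rewrite mulrCA sx mulrA.
- by exists a => //; exists 1 => //; exists 1.
- by move=> [s Qs [c]]; rewrite mulr1 => sE; apply: Qs; rewrite sE; apply: QZ.
- move=> [t Qt [c tsx]]; exists (t * s); first by move/Qmul=> [].
  by exists c; rewrite -mulrA.
have [n [g Qg]] : finitely_generated Q by case: dedR => + _ _; apply.
have gQ i : Q (g i) by rewrite Qg; apply: generator_mem.
have /choice[s sP] : forall i, exists s,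
    ~ Q s /\ exists c, s * (g i * b) = c * a.
  by move=> i; have [s Qs sg] := QJ _ (gQ i); exists s.
pose t := \prod_(i < n) s i; exists a, (t * b); split=> //.
  move=> [c tb]; apply: Jb; exists t; last by exists c.
  by apply: prime_prod => // i; case: (sP i).
have /choice[d dP] : forall i, exists d, t * (g i * b) = d * a.
  move=> i; have [_ [c sg]] := sP i; rewrite /t (bigD1 i) //=.
  by exists (c * \prod_(j < n | j != i) s j); rewrite mulrAC sg mulrAC.
move=> q; rewrite {1}Qg => -[c ->]; exists (\sum_i c i * d i).
rewrite !mulr_suml; apply: eq_bigr => i _.
by rewrite -!mulrA -dP; congr (_ * _); rewrite mulrCA.
Qed.

End Dedekind.

(** The determinant trick: multiplication by [z] on generators of [J] is given
    by a matrix over [R], whose characteristic polynomial has the root [z]. *)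
Lemma stable_integral J (z : {fraction R}) : finitely_generated J ->
    (exists2 x, J x & x != 0) ->
    (forall r, J r -> exists2 r', J r' & z * r%:F = r'%:F) ->
  integralOver (@tofrac R) z.
Proof.
move=> [n [g Jg]] [y Jy yn0] zJ.
have gJ i : J (g i) by rewrite Jg; apply: generator_mem.
have /choice[c cP] : forall j, exists c : 'I_n -> R,
    z * (g j)%:F = (\sum_(i < n) c i * g i)%:F.
  by move=> j; have [r' + ->] := zJ _ (gJ j); rewrite {1}Jg => -[c ->]; exists c.
pose A := \matrix_(i, j) c j i.
exists (char_poly A); first exact: char_poly_monic.
rewrite map_char_poly -eigenvalue_root_char; apply/eigenvalueP.
exists (\row_i (g i)%:F).
  apply/rowP => j; rewrite !mxE cP rmorph_sum; apply: eq_bigr => i _.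
  by rewrite !mxE rmorphM mulrC.
apply/eqP => /rowP g0; move: Jy yn0; rewrite Jg => -[d ->] /eqP; apply.
rewrite big1 // => i _; have /eqP := g0 i; rewrite !mxE tofrac_eq0 => /eqP ->.
by rewrite mulr0.
Qed.

End Ideals.

(** * Submodules of the fraction field and their localizations *)

Section Localization.
Variable R : idomainType.
Local Notation K := {fraction R}.
Local Notation A := (base_ring R).
Implicit Types (I J L M : set K) (P Q : set R) (x y z : K).

Lemma fractionP x : exists a b : R, b != 0 /\ x = a%:F / b%:F.
Proof.
elim/quotW: x => -[[a b] /= bn0]; exists a, b; split=> //.
apply: (canRL (mulfK _)); first by rewrite tofrac_eq0.
unlock tofrac; rewrite -[LHS]FracField.pi_mul; apply/eqmodP => /=.
rewrite FracField.equivfE /FracField.mulf /= !numden_Ratio ?oner_neq0 ?mulr1 //.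
by rewrite mulrC.
Qed.

Lemma frac_imageE (S : set R) r : frac_image S r%:F <-> S r.
Proof.
split=> [[s Ss /eqP]|Sr]; last by exists r.
by rewrite tofrac_eq => /eqP <-.
Qed.

Lemma base_ring_tofrac r : A r%:F.
Proof. by exists r. Qed.

Lemma submodule_frac_image (J : set R) : ideal J -> submodule A (frac_image J).
Proof.
move=> /idealP[J0 JD JZ]; split.
- by exists 0; rewrite ?tofrac0.
- by move=> _ _ [r Jr <-] [s Js <-]; rewrite -tofracD; apply/frac_imageE/JD.
- by move=> _ _ [a _ <-] [r Jr <-]; rewrite -tofracM; apply/frac_imageE/JZ.
Qed.

Lemma unital_base_ring : unital A.
Proof.
split; last by rewrite -tofrac1; apply: base_ring_tofrac.
by apply: submodule_frac_image; apply/idealP; split.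
Qed.

Lemma ideal_preimage L : submodule A L -> ideal [set r | L r%:F].
Proof.
move=> [L0 LD LZ]; apply/idealP; split=> [|r s Lr Ls|a r Lr] /=.
- by rewrite tofrac0.
- by rewrite tofracD; apply: LD.
- by rewrite tofracM; apply: LZ => //; apply: base_ring_tofrac.
Qed.

Lemma frac_image_preimage L : L `<=` A -> frac_image [set r | L r%:F] = L.
Proof.
move=> LA; apply/seteqP; split=> [_ [r Lr <-] //|x Lx].
by have [r _ rx] := LA x Lx; exists r; rewrite //= rx.
Qed.

(** Multiplying by its own denominator turns a common denominator of [I], and
    likewise a nonzero member of [I], into an element of [R]. *)
Lemma fractional_idealP I : fractional_ideal A I -> exists a c : R,
  [/\ a != 0, c != 0, forall y, I y -> A (a%:F * y) & I c%:F].
Proof.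
move=> [[_ _ IZ] [y Iy yn0] [x xn0 xI]].
have [a [b [bn0 xE]]] := fractionP x; have [c [d [dn0 yE]]] := fractionP y.
have aE : a%:F = b%:F * x by rewrite xE mulrCA divff ?tofrac_eq0 ?mulr1.
have cE : c%:F = d%:F * y by rewrite yE mulrCA divff ?tofrac_eq0 ?mulr1.
exists a, c; split.
- by rewrite -tofrac_eq0 aE mulf_neq0 ?tofrac_eq0.
- by rewrite -tofrac_eq0 cE mulf_neq0 ?tofrac_eq0.
- move=> t It; rewrite aE -mulrA; have [[_ _ AZ] _] := unital_base_ring.
  by apply: AZ (base_ring_tofrac b) (xI _ It).
- by rewrite cE; apply: IZ (base_ring_tofrac d) Iy.
Qed.

Section AtPrime.
Variable P : set R.
Hypothesis Ppr : nonzero_prime P.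
Local Notation AP := (localize P A).

Lemma denom_neq0 s : ~ P s -> s%:F != 0.
Proof.
have [/idealP[P0 _ _] _ _ _] := (nonzero_primeP P).1 Ppr.
by move=> Ps; rewrite tofrac_eq0; apply: contra_notN Ps => /eqP ->.
Qed.

Lemma denomM s t : ~ P s -> ~ P t -> ~ P (s * t).
Proof. by case/nonzero_primeP: Ppr => _ _ Pmul _ Ps Pt /Pmul[]. Qed.

Lemma sub_localize I : I `<=` localize P I.
Proof.
move=> x Ix; exists x, 1; rewrite tofrac1 divr1; split=> //.
by case/nonzero_primeP: Ppr.
Qed.

Lemma localizeS I J : I `<=` J -> localize P I `<=` localize P J.
Proof. by move=> IJ _ [a [s [Ia Ps ->]]]; exists a, s; split=> //; apply: IJ. Qed.

Lemma submodule_localize I : submodule A I -> submodule AP (localize P I).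
Proof.
move=> [I0 ID IZ]; split; first exact: sub_localize.
  move=> _ _ [a [s [Ia Ps ->]]] [b [t [Ib Pt ->]]].
  exists (t%:F * a + s%:F * b), (s * t); split; last 1 first.
  - rewrite addf_div ?denom_neq0 // tofracM.
    by congr (_ / _); rewrite mulrC [b * _]mulrC.
  - by apply: ID; apply: IZ => //; apply: base_ring_tofrac.
  - exact: denomM.
move=> _ _ [a [s [Aa Ps ->]]] [b [t [Ib Pt ->]]].
exists (a * b), (s * t); split; [exact: IZ|exact: denomM|].
by rewrite mulf_div tofracM.
Qed.

Lemma unital_localize : unital AP.
Proof.
split; first exact: submodule_localize unital_base_ring.1.
exact/sub_localize/unital_base_ring.2.
Qed.

Lemma localize_mul I J : submodule A I ->
  localize P (mul_submod I J) = mul_submod (localize P I) (localize P J).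
Proof.
move=> Isub; have [m0 mD] := additive_mul_submod (localize P I) (localize P J).
apply/seteqP; split=> [_ [a [s [IJa Ps ->]]]|].
  move: a IJa; apply: mul_submod_sub => [|x y Ix Jy].
    by split=> [|x y]; rewrite ?mul0r ?mulrDl //; apply: mD.
  by rewrite mulrAC; apply: mem_mul_submod; [exists x, s|apply: sub_localize].
apply: mul_submod_sub.
  exact/(@submodule_additive _ AP)/submodule_localize/submodule_mul.
move=> _ _ [a [s [Ia Ps ->]]] [b [t [Jb Pt ->]]].
exists (a * b), (s * t); split; [exact: mem_mul_submod|exact: denomM|].
by rewrite mulf_div tofracM.
Qed.

Lemma fractional_localize I :
  fractional_ideal A I -> fractional_ideal AP (localize P I).
Proof.
move=> [Isub [y Iy yn0] [x xn0 xI]]; split; first exact: submodule_localize.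
  by exists y => //; apply: sub_localize.
exists x => // _ [a [s [Ia Ps ->]]]; exists (x * a), s.
by split; [apply: xI| |rewrite mulrA].
Qed.

Lemma localize_exp I J k : submodule A I ->
    fractional_ideal A J -> mul_submod I J = A ->
  localize P (exp_frac A I k) = exp_frac AP (localize P I) k.
Proof.
move=> Isub Jfr IJ; have [Jsub _ _] := Jfr.
have iterE L n : submodule A L ->
    localize P (iter n (mul_submod L) A) = iter n (mul_submod (localize P L)) AP.
  by move=> Lsub; elim: n => //= n IHn; rewrite localize_mul // IHn.
case: k => n; rewrite /exp_frac; first exact: iterE.
rewrite (inv_frac_unique unital_base_ring Jfr IJ) iterE //.
rewrite (inv_frac_unique unital_localize (fractional_localize Jfr)) //.
by rewrite -localize_mul // IJ.
Qed.

Lemma localize_full L s :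
  submodule A L -> L `<=` A -> L s%:F -> ~ P s -> localize P L = AP.
Proof.
move=> [_ _ LZ] LA Ls Ps; apply/seteqP; split; first exact: localizeS.
move=> _ [a [t [Aa Pt ->]]]; exists (a * s%:F), (s * t).
split; [exact: LZ|exact: denomM|].
by rewrite tofracM invfM mulrA mulfK // denom_neq0.
Qed.

Lemma localize_prime_proper : localize P (frac_image P) <> AP.
Proof.
move=> PA; have := unital_localize.2; rewrite -PA => -[_ [s [[p Pp <-] Ps oneE]]].
apply: (Ps); apply/frac_imageE; exists p => //.
by rewrite -[LHS](divfK (denom_neq0 Ps)) -oneE mul1r.
Qed.

End AtPrime.

(** * Fractional ideals of a Dedekind domain *)

Section Dedekind.
Hypothesis dedR : dedekind R.

Lemma stable_base_ring (J : set R) z : ideal J ->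
    (exists2 r, J r & r != 0) ->
    (forall r, J r -> exists2 r', J r' & z * r%:F = r'%:F) ->
  A z.
Proof.
move=> Jid Jn0 zJ; have [noethR intR _] := dedR.
by have [a ->] := intR _ (stable_integral (noethR _ Jid) Jn0 zJ); exists a.
Qed.

(** The inverse consists of the [z] that multiply [P] into [R]; its product with
    [P] is an ideal between [P] and [R], hence one of these two.  It is not [P]:
    a fraction outside [R] belongs to the inverse, and if it multiplied [P] into
    [P], it would be integral. *)
Lemma nonzero_prime_inverse P : nonzero_prime P -> exists J,
  [/\ fractional_ideal A J, mul_submod (frac_image P) J = A, A `<=` J
    & exists2 z, J z & ~ A z].
Proof.
move=> Ppr; have [Pid P1 _ Pn0] := (nonzero_primeP P).1 Ppr.
have [[A0 AD AZ] A1] := unital_base_ring.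
pose J := [set z : K | forall q, P q -> A (z * q%:F)].
have AJ : A `<=` J by move=> _ [r _ <-] q _; rewrite -tofracM; exists (r * q).
have Jfr : fractional_ideal A J.
  split; first split.
  - exact: AJ.
  - by move=> x y Jx Jy q Pq; rewrite mulrDl; apply: AD; [apply: Jx|apply: Jy].
  - by move=> a x Aa Jx q Pq; rewrite -mulrA; apply: AZ => //; apply: Jx.
  - by exists 1; rewrite ?oner_neq0 //; apply: AJ.
  case: Pn0 => q Pq qn0; exists q%:F; first by rewrite tofrac_eq0.
  by move=> y Jy; rewrite mulrC; apply: Jy.
have [a [b [an0 ab PbA]]] := exists_conductor dedR Ppr.
have aF : a%:F != 0 by rewrite tofrac_eq0.
have Jz : J (b%:F / a%:F).
  move=> q /PbA[c qb]; exists c => //; rewrite mulrAC.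
  by apply: (canRL (mulfK aF)); rewrite -!tofracM -qb mulrC.
have Az : ~ A (b%:F / a%:F).
  case=> c _ cE; apply: ab; exists c; apply/eqP.
  by rewrite -tofrac_eq tofracM cE divfK.
exists J; split=> //; last by exists (b%:F / a%:F).
set M := mul_submod _ _; have Msub : submodule A M.
  exact/submodule_mul/submodule_frac_image.
have MA : M `<=` A.
  apply: mul_submod_sub => // _ y [q Pq <-] Jy.
  by rewrite mulrC; apply: Jy.
have [M1|M1] := pselect (M 1).
  apply/seteqP; split=> // x Ax; rewrite -[x]mulr1.
  by case: Msub => _ _; apply.
have PM : [set r | M r%:F] = P.
  case: dedR => _ _; apply=> //.
    by apply/proper_ideal_setP; split; [apply: ideal_preimage|rewrite /= tofrac1].
  move=> q Pq; rewrite /= -[q%:F]mulr1; apply: mem_mul_submod.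
    exact/frac_imageE.
  exact: AJ.
case: Az; apply: stable_base_ring Pid Pn0 _ => r Pr.
have Mzr : M (b%:F / a%:F * r%:F).
  by rewrite mulrC; apply: mem_mul_submod Jz; apply/frac_imageE.
by have [r' _ r'E] := MA _ Mzr; exists r'; rewrite // -PM /= r'E.
Qed.

Section PrimePowers.
Variable P : set R.
Hypothesis Ppr : nonzero_prime P.
Local Notation AP := (localize P A).
Local Notation PP := (localize P (frac_image P)).

Lemma submodule_prime : submodule A (frac_image P).
Proof. by apply: submodule_frac_image; case/nonzero_primeP: Ppr. Qed.

(** An ideal [J] inside [P] becomes strictly larger when multiplied by the
    inverse of [P], because elements of this inverse outside [R] cannot
    stabilize [J]; induction applies to the larger ideal. *)
Lemma localize_ideal_power (J : set R) : ideal J ->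
    (exists2 r, J r & r != 0) ->
  exists n : nat, localize P (frac_image J) = exp_frac AP PP (Posz n).
Proof.
have noethR : noetherian R by case: dedR.
have [N [Nfr PN AN [z Nz Az]]] := nonzero_prime_inverse Ppr.
have [Nsub _ _] := Nfr.
move: J; apply: noetherian_ind => // J Jid IHJ Jn0.
have Jsub := submodule_frac_image Jid.
have [JP|/existsNP[s /not_implyP[Js Ps]]] := pselect (J `<=` P); last first.
  exists 0%N; apply: (localize_full Ppr Jsub _ _ Ps).
    exact: image_subset.
  exact/frac_imageE.
pose M := mul_submod N (frac_image J).
have MA : M `<=` A.
  rewrite -PN mul_submodC; apply: mul_submodS => //; exact: image_subset.
have Msub : submodule A M by apply: submodule_mul.
have subJM r : J r -> M r%:F.
  move=> Jr; rewrite -[r%:F]mul1r; apply: mem_mul_submod.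
    exact/AN/unital_base_ring.2.
  exact/frac_imageE.
have [|||n IHn] := IHJ [set r | M r%:F].
- exact: ideal_preimage.
- split=> [//|MJ]; apply: Az; apply: stable_base_ring Jid Jn0 _ => r Jr.
  have Mzr : M (z * r%:F) by apply: mem_mul_submod => //; apply/frac_imageE.
  have [r' _ r'E] := MA _ Mzr; exists r'; last by [].
  by apply: MJ; rewrite /= r'E.
- by case: Jn0 => r Jr rn0; exists r => //; apply: subJM.
exists n.+1; rewrite frac_image_preimage // in IHn.
have NP : mul_submod N (frac_image P) = A by rewrite mul_submodC.
rewrite -(mul_submodKl unital_base_ring Jsub NP) localize_mul ?IHn //.
exact: submodule_prime.
Qed.

Lemma localize_inverse : exists2 N,
  fractional_ideal AP N & mul_submod PP N = AP.
Proof.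
have [N [Nfr PN _ _]] := nonzero_prime_inverse Ppr.
exists (localize P N); first exact: fractional_localize.
by rewrite -localize_mul ?PN //; apply: submodule_prime.
Qed.

Lemma valuationP I : fractional_ideal A I ->
  localize P I = exp_frac AP PP (valuation P I).
Proof.
move=> Ifr; have [Isub _ _] := Ifr.
apply: (@xgetPex _ _ [set k | localize P I = exp_frac AP PP k]).
have [a [c [an0 cn0 aI Ic]]] := fractional_idealP Ifr.
have [N Nfr PN] := localize_inverse.
have unitAP := unital_localize Ppr.
pose aR := [set r | exists d, r = d * a].
have aRid : ideal aR.
  apply/idealP; split=> [|_ _ [d ->] [e ->]|d _ [e ->]].
  - by exists 0; rewrite mul0r.
  - by exists (d + e); rewrite mulrDl.
  - by exists (d * e); rewrite mulrA.
have aRn0 : exists2 r, aR r & r != 0 by exists a => //; exists 1; rewrite mul1r.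
have aRsub := submodule_frac_image aRid.
pose M := mul_submod (frac_image aR) I.
have Msub : submodule A M by apply: submodule_mul.
have [[A0 AD AZ] _] := unital_base_ring.
have MA : M `<=` A.
  apply: mul_submod_sub => // _ y [_ [d ->] <-] Iy.
  by rewrite tofracM -mulrA; apply: AZ (base_ring_tofrac d) (aI _ Iy).
have [m am] := localize_ideal_power aRid aRn0.
have [|n] := localize_ideal_power (ideal_preimage Msub).
  exists (a * c); last exact: mulf_neq0.
  rewrite /= tofracM; apply: mem_mul_submod => //; apply/frac_imageE.
  by exists 1; rewrite mul1r.
rewrite frac_image_preimage // localize_mul // am => Mn.
exists (n%:Z - m%:Z); apply: (exp_frac_cancel unitAP Nfr PN (n := m)).
- exact: submodule_localize.
- exact: submodule_exp.
by rewrite (exp_fracD unitAP Nfr PN) Mn addrC subrK.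
Qed.

Lemma valuation_eq0 I :
  fractional_ideal A I -> localize P I = AP -> valuation P I = 0.
Proof.
move=> Ifr IA; have [N Nfr PN] := localize_inverse.
have := valuationP Ifr; rewrite IA => /esym.
apply: (exp_frac_eq1 (unital_localize Ppr) Nfr PN).
- exact/submodule_localize/submodule_prime.
- exact/localizeS/image_subset.
- exact: localize_prime_proper.
Qed.

Lemma localize_other_prime Q : nonzero_prime Q -> Q <> P ->
  localize P (frac_image Q) = AP.
Proof.
move=> Qpr QP; have [Qid _ _ _] := (nonzero_primeP Q).1 Qpr.
have [/(nonzero_prime_maximal dedR Qpr Ppr) //|] := pselect (Q `<=` P).
move=> /existsNP[s /not_implyP[Qs Ps]].
apply: (localize_full Ppr (submodule_frac_image Qid) _ _ Ps).
  exact: image_subset.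
exact/frac_imageE.
Qed.

End PrimePowers.

(** For [x] in [I], the [r] with [r * x] in [J] form a nonzero ideal.  If it were
    proper it would lie in a nonzero prime [P], but [x] has, modulo [J], a
    denominator outside [P]. *)
Lemma sub_local_global I J : submodule A J -> (exists2 y, J y & y != 0) ->
    (forall P, nonzero_prime P -> localize P I `<=` localize P J) ->
  I `<=` J.
Proof.
move=> [J0 JD JZ] [y Jy yn0] locIJ x Ix.
have noethR : noetherian R by case: dedR.
pose D := [set r : R | J (r%:F * x)].
have Did : ideal D.
  apply/idealP; split=> [|r s|a r] /=; rewrite /D /=.
  - by rewrite tofrac0 mul0r.
  - by rewrite tofracD mulrDl; apply: JD.
  - by rewrite tofracM -mulrA; apply: JZ (base_ring_tofrac a).
have [D1|D1] := pselect (D 1); first by move: D1; rewrite /D /= tofrac1 mul1r.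
have [|P Ppr DP] := sub_nonzero_prime noethR Did D1.
  have [a [b [bn0 xE]]] := fractionP x; have [c [d [dn0 yE]]] := fractionP y.
  have cE : c%:F = d%:F * y by rewrite yE mulrCA divff ?tofrac_eq0 ?mulr1.
  exists (c * b).
    rewrite /D /= tofracM xE -mulrA [b%:F * _]mulrC divfK ?tofrac_eq0 //.
    rewrite mulrC cE mulrA -tofracM.
    exact: JZ (base_ring_tofrac _) Jy.
  by rewrite mulf_neq0 // -tofrac_eq0 cE mulf_neq0 ?tofrac_eq0.
have [j [s [Jj Ps xE]]] := locIJ P Ppr x (sub_localize Ppr Ix).
case: (Ps); apply: DP; rewrite /D /= xE mulrC divfK //.
exact: (denom_neq0 Ppr Ps).
Qed.

End Dedekind.
End Localization.

(** * The factorization *)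

(** Only primes dividing [a * c] can occur, where [a] multiplies [I] into [R] and
    [c] is in [I]: at the other primes both are units. *)
Lemma finite_valuation_support (R : idomainType) (I : set {fraction R}) :
    dedekind R -> fractional_ideal (base_ring R) I ->
  finite_set [set P : set R | nonzero_prime P /\ valuation P I <> 0].
Proof.
move=> dedR Ifr; have [Isub _ _] := Ifr; have [_ _ IZ] := Isub.
have [a [c [an0 cn0 aI Ic]]] := fractional_idealP Ifr.
pose D := [set r | exists d, r = d * (a * c)].
have Did : ideal D.
  apply/idealP; split=> [|_ _ [d ->] [e ->]|d _ [e ->]].
  - by exists 0; rewrite mul0r.
  - by exists (d + e); rewrite mulrDl.
  - by exists (d * e); rewrite mulrA.
have : finite_set [set P | nonzero_prime P /\ D `<=` P].
  apply: finite_primes_above => //; exists (a * c); last exact: mulf_neq0.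
  by exists 1; rewrite mul1r.
apply: sub_finite_set => P [Ppr vP]; split=> // _ [d ->].
have [/idealP[_ _ PZ] _ _ _] := (nonzero_primeP P).1 Ppr; apply: (PZ d).
apply: contrapT => Pac; apply: vP; apply: (valuation_eq0 dedR Ppr Ifr).
have Pa : ~ P a by move=> Pa; apply: Pac; rewrite mulrC; apply: (PZ c).
have Pc : ~ P c by move=> Pc; apply: Pac; apply: (PZ a).
apply/seteqP; split=> _ [y [s [Iy Ps ->]]].
  exists (a%:F * y), (a * s); split; [exact: aI|exact: denomM|].
  by rewrite tofracM -mulf_div divff ?mul1r // (denom_neq0 Ppr).
exists (y * c%:F), (s * c); split; [exact: IZ|exact: denomM|].
by rewrite tofracM -mulf_div divff ?mulr1 // (denom_neq0 Ppr).
Qed.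

Section PrimeFactorization.
Variables (R : idomainType) (dedR : dedekind R).
Local Notation A := (base_ring R).
Variables (k : nat) (p : 'I_k -> set R) (v : 'I_k -> int).
Hypotheses (p_inj : injective p) (p_prime : forall i, nonzero_prime (p i)).

Let factor i := exp_frac A (frac_image (p i)) (v i).
Let product := \big[@mul_submod {fraction R}/A]_(i < k) factor i.

Lemma submodule_prime_product : submodule A product.
Proof.
apply: big_ind; first exact: (unital_base_ring R).1.
  by move=> I J Isub _; apply: submodule_mul.
by move=> i _; apply/submodule_exp/unital_base_ring.
Qed.

Lemma prime_product_neq0 : exists2 y, product y & y != 0.
Proof.
pose nz (I : set {fraction R}) := exists2 y, I y & y != 0.
have nzM I J : nz I -> nz J -> nz (mul_submod I J).
  move=> [x Ix xn0] [y Jy yn0].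
  by exists (x * y); [apply: mem_mul_submod|apply: mulf_neq0].
have nzA : nz A by exists 1; [apply: (unital_base_ring R).2|apply: oner_neq0].
have nz_iter I n : nz I -> nz (iter n (mul_submod I) A).
  by move=> In0; elim: n => //= n; apply: nzM.
apply: (big_ind nz) => // i _; rewrite /factor /exp_frac.
have [N [Nfr pN _ _]] := nonzero_prime_inverse dedR (p_prime i).
have [_ Nn0 _] := Nfr.
case: (v i) => n; apply: nz_iter.
  have [_ _ _ [q pq qn0]] := (nonzero_primeP _).1 (p_prime i).
  by exists q%:F; [apply/frac_imageE|rewrite tofrac_eq0].
by rewrite (inv_frac_unique (unital_base_ring R) Nfr pN).
Qed.

(** Localization at [P] commutes with products and powers, and makes every prime
    other than [P] trivial. *)
Lemma localize_prime_product P : nonzero_prime P ->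
    (forall i, P <> p i) /\ localize P product = localize P A
    \/ exists i, P = p i /\ localize P product =
         exp_frac (localize P A) (localize P (frac_image P)) (v i).
Proof.
move=> Ppr; have unitAP := unital_localize Ppr.
have -> : localize P product =
    \big[@mul_submod {fraction R}/localize P A]_(i < k) localize P (factor i).
  suff [] : submodule A product /\ localize P product =
    \big[@mul_submod {fraction R}/localize P A]_(i < k) localize P (factor i) by [].
  rewrite /product; elim/big_rec2: _ => [|i L J _ [Jsub <-]].
    by split=> //; apply: (unital_base_ring R).1.
  have Fsub : submodule A (factor i) by apply/submodule_exp/unital_base_ring.
  by split; [apply: submodule_mul|rewrite localize_mul].
have locE i : localize P (factor i) =
    exp_frac (localize P A) (localize P (frac_image (p i))) (v i).
  have [N [Nfr pN _ _]] := nonzero_prime_inverse dedR (p_prime i).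
  exact: localize_exp (submodule_prime (p_prime i)) Nfr pN.
have loc1 i : P <> p i -> localize P (factor i) = localize P A.
  move=> Pp; rewrite locE (localize_other_prime dedR Ppr (p_prime i)).
    exact: exp_frac1.
  exact: nesym.
have [[i Pi]|nP] := pselect (exists i, P = p i); [right|left].
  exists i; split=> //; transitivity (localize P (factor i)); last by rewrite locE -Pi.
  rewrite (big_mul_submod_single unitAP (t := i)) ?index_enum_uniq //.
  - by rewrite mem_index_enum.
  - by rewrite locE; apply: submodule_exp.
  - move=> j ji; apply: loc1; rewrite Pi => /p_inj /eqP.
    by rewrite eq_sym (negbTE ji).
have Pp i : P <> p i by move=> Pi; apply: nP; exists i.
split=> //; apply: (big_ind (fun L => L = localize P A)) => //.
  by move=> _ _ -> ->; apply: mul1_submod unitAP _ unitAP.1.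
by move=> i _; apply: loc1.
Qed.

End PrimeFactorization.

Theorem theorem83 (R : idomainType) (I : set {fraction R})
    (hR : dedekind R) (hI : fractional_ideal (base_ring R) I) :
  finite_set [set P : set R | nonzero_prime P /\ valuation P I <> 0] /\
  (forall (k : nat) (p : 'I_k -> set R),
     injective p ->
     (forall i, nonzero_prime (p i)) ->
     (forall P : set R, nonzero_prime P -> valuation P I <> 0 ->
        exists i, P = p i) ->
     I = \big[@mul_submod {fraction R} / base_ring R]_(i < k)
           exp_frac (base_ring R) (frac_image (p i)) (valuation (p i) I)).
Proof.
split; first exact: finite_valuation_support.
move=> k p p_inj p_prime p_supp; set J := bigop _ _ _.
have Jsub : submodule (base_ring R) J by apply: submodule_prime_product.
have Jn0 : exists2 y, J y & y != 0 by apply: prime_product_neq0.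
have [Isub In0 _] := hI.
have locIJ P : nonzero_prime P -> localize P I = localize P J.
  move=> Ppr; rewrite (valuationP hR Ppr hI).
  have [[Pp ->]|[i [-> ->]] //] :=
    localize_prime_product hR (fun i => valuation (p i) I) p_inj p_prime Ppr.
  suff -> : valuation P I = 0 by [].
  by apply: contrapT => /(p_supp P Ppr)[i /Pp].
apply/seteqP; split; apply: sub_local_global => // P Ppr; first by rewrite locIJ.
by rewrite locIJ.
Qed.
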